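(* Given any parameter $\alpha\in[\tfrac12,1)$, for any bandit algorithm that achieves an additive regret upper bound of the form $O(T^\alpha+C^\beta)$, we have $\beta\ge\frac1\alpha$.
   Context: Stochastic multi-armed bandit with adversarial attacks. There are $K\in\mathbb N^+$ arms $\mathcal K=\{1,\dots,K\}$; arm $k$ is associated with a reward random variable $X_k\in[0,1]$ with unknown mean $\mu_k$. The arm of highest mean, $k^*$, is unique. $T$ is the number of decision rounds. In each round $t\in\mathcal T=\{1,\dots,T\}$: the learner (the bandit algorithm) pulls an arm $I_t$; a stochastic reward $X_{I_t,t}$ is drawn from this arm; the adversary observes $I_t$ and $X_{I_t,t}$ and then chooses an attacked reward $\tilde X_{I_t,t}$; the learner observes only $\tilde X_{I_t,t}$, not $X_{I_t,t}$. The total attack is $C=\sum_{t=1}^T|X_{I_t,t}-\tilde X_{I_t,t}|$. The (realized) regret is defined on the raw rewards as $R_T=\max_{k\in\mathcal K}\sum_{t\in\mathcal T}(X_{k,t}-X_{I_t,t})$; the pseudo-regret is $\bar R_T=\mathbb E\big[T\mu_{k^*}-\sum_{t\in\mathcal T}\mu_{I_t}\big]\le\mathbb E[R_T]$. *)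

(* Defs.v *)
From HB Require Import structures.
From mathcomp Require Import all_boot all_order all_algebra.
From mathcomp Require Import all_classical all_reals all_analysis.

Set Implicit Arguments.
Unset Strict Implicit.
Unset Printing Implicit Defensive.

Import Order.TTheory GRing.Theory Num.Theory.
Import numFieldNormedType.Exports.

Local Open Scope classical_set_scope.
Local Open Scope ring_scope.

(* Arms carry the discrete sigma-algebra.  Measurable types are pointed, hence
   the index type ['I_K.+1]: there are [K.+1] arms throughout. *)
HB.instance Definition _ (K : nat) := isPointed.Build 'I_K.+1 ord0.
HB.instance Definition _ (K : nat) :=
  @isMeasurable.Build default_measure_display 'I_K.+1
    discrete_measurable discrete_measurable0
    discrete_measurableC discrete_measurableU.

Definition mean (R : realType) (nu : probability R R) : R := fine 'E_nu[id].

Record instance (R : realType) (K : nat) := Instance {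
  law : 'I_K.+1 -> probability R R;
  law_itv01 : forall k, law k `[0, 1]%classic = 1%E;
  best : 'I_K.+1;
  best_uniq : forall k, k != best -> mean (law k) < mean (law best) }.

(* Rounds are numbered from 0.  Histories list the most recent round first.
   The decision rule may depend on the horizon [T], and is randomized through
   a seed in [U]; it sees the past arms and the past attacked rewards. *)
Record algorithm (R : realType) (K : nat) (dU : measure_display)
    (U : measurableType dU) := Algorithm {
  seed_law : probability U R;
  pull : forall T t : nat, U * t.-tuple ('I_K.+1 * R) -> 'I_K.+1;
  measurable_pull : forall T t, measurable_fun setT (@pull T t) }.

(* The attack of round [t] is a function of the adversary's own seed in [V]
   and of the arms and raw rewards of rounds 0, ..., t (its own past attacks
   are functions of these). *)
Record adversary (R : realType) (K : nat) (dV : measure_display)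
    (V : measurableType dV) := Adversary {
  adv_seed_law : probability V R;
  attack : forall t : nat, V * t.+1.-tuple ('I_K.+1 * R) -> R;
  measurable_attack : forall t, measurable_fun setT (@attack t) }.

(* A probability space carrying the two seeds and all raw rewards [X k t].
   [joint_law] states that they are mutually independent with the prescribed
   marginals: their joint law over any number of rounds is the product one. *)
Record environment (R : realType) (K : nat) (nu : instance R K)
    (dU : measure_display) (U : measurableType dU) (alg : algorithm R K U)
    (dV : measure_display) (V : measurableType dV) (adv : adversary R K V)
    (dO : measure_display) (Omega : measurableType dO) := Environment {
  Pr : probability Omega R;
  seed : {RV Pr >-> U};
  adv_seed : {RV Pr >-> V};
  reward : 'I_K.+1 -> nat -> {RV Pr >-> R};
  joint_law : forall (n : nat) (A : set U) (B : set V)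
      (E : 'I_K.+1 -> nat -> set R),
    measurable A -> measurable B -> (forall k t, measurable (E k t)) ->
    Pr [set w | [/\ A (seed w), B (adv_seed w) &
                    forall k t, (t < n)%N -> E k t (reward k t w)]] =
    (seed_law alg A * adv_seed_law adv B *
     \prod_(k < K.+1) \prod_(t < n) law nu k (E k t))%E }.

Section Interaction.
Context (R : realType) (K : nat) (nu : instance R K).
Context (dU : measure_display) (U : measurableType dU) (alg : algorithm R K U).
Context (dV : measure_display) (V : measurableType dV) (adv : adversary R K V).
Context (dO : measure_display) (Omega : measurableType dO).
Context (env : environment nu alg adv Omega) (T : nat).

(* Raw history (seen by the adversary) and attacked history (seen by the
   learner) of the first [t] rounds. *)
Fixpoint histories (w : Omega) (t : nat) :
    t.-tuple ('I_K.+1 * R) * t.-tuple ('I_K.+1 * R) :=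
  match t with
  | 0 => ([tuple], [tuple])
  | t'.+1 =>
    let h := histories w t' in
    let i := pull alg T (seed env w, h.2) in
    let raw := [tuple of (i, reward env i t' w) :: h.1] in
    (raw, [tuple of (i, attack adv (adv_seed env w, raw)) :: h.2])
  end.

Definition pulled (t : nat) (w : Omega) : 'I_K.+1 :=
  pull alg T (seed env w, (histories w t).2).

Definition raw_reward (t : nat) (w : Omega) : R :=
  reward env (pulled t w) t w.

Definition attacked_reward (t : nat) (w : Omega) : R :=
  attack adv (adv_seed env w,
    [tuple of (pulled t w, raw_reward t w) :: (histories w t).1]).

Definition total_attack (w : Omega) : R :=
  \sum_(t < T) `|raw_reward t w - attacked_reward t w|.

Definition regret_against (k : 'I_K.+1) (w : Omega) : R :=
  \sum_(t < T) (reward env k t w - raw_reward t w).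

(* The regrets against the various arms may all be negative, so the maximum
   starts from one of them rather than from 0. *)
Definition realized_regret (w : Omega) : R :=
  \big[Num.max/regret_against ord0 w]_(k < K.+1) regret_against k w.

Definition pseudo_regret : \bar R :=
  'E_(Pr env)[(fun w => T%:R * mean (law nu (best nu)) -
                        \sum_(t < T) mean (law nu (pulled t w)))%R]%E.

End Interaction.

(* In both bounds the algorithm is not told [c], an almost sure upper bound on
   the total attack; and the hidden constant [M] depends neither on the
   horizon nor on the adversary nor on [c], but may depend on the instance.
   Attack-free runs are included, since [c] only bounds the attack; asking for
   [0 < c] avoids the junk value of [0 `^ b] when [b < 0]. *)
Definition pseudo_regret_bound (R : realType) (K : nat)
    (dU : measure_display) (U : measurableType dU) (alg : algorithm R K U)
    (a b : R) : Prop :=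
  forall nu : instance R K, exists M : R,
  forall (T : nat) (dV : measure_display) (V : measurableType dV)
    (adv : adversary R K V) (dO : measure_display) (Omega : measurableType dO)
    (env : environment nu alg adv Omega) (c : R),
  (0 < T)%N -> 0 < c ->
  {ae Pr env, forall w, total_attack env T w <= c} ->
  (pseudo_regret env T <= (M * (T%:R `^ a + c `^ b))%:E)%E.

Definition realized_regret_bound (R : realType) (K : nat)
    (dU : measure_display) (U : measurableType dU) (alg : algorithm R K U)
    (a b : R) : Prop :=
  forall (nu : instance R K) (delta : R), 0 < delta < 1 -> exists M : R,
  forall (T : nat) (dV : measure_display) (V : measurableType dV)
    (adv : adversary R K V) (dO : measure_display) (Omega : measurableType dO)
    (env : environment nu alg adv Omega) (c : R),
  (0 < T)%N -> 0 < c ->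
  {ae Pr env, forall w, total_attack env T w <= c} ->
  ((1 - delta)%:E <=
   Pr env [set w | (realized_regret env T w <= M * (T%:R `^ a + c `^ b))%R])%E.

(* Main.v *)
(** Two instances with deterministic rewards are confused with each other.  In
    the first one arm [0] pays 1/2 and all other arms pay 0; in the second one
    the last arm pays 1 instead of 0.  In both, the adversary shows 0 for the
    last arm during its first [c] pulls.  In the first instance this is no
    attack at all, so with good probability the last arm is pulled at most
    [A * T `^ alpha =: c] times.  As the learner cannot tell the instances apart
    until the budget [c] is exhausted, the same seed makes it pull the last arm
    at most [c] times in the second instance too, where its regret is then at
    least [(T - c) / 2].  The assumed bound forces [T = O(T `^ g)] with [g] the
    maximum of [alpha] and [alpha * beta], hence [1 <= alpha * beta]. *)
Require Import Defs.
From HB Require Import structures.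
From mathcomp Require Import all_boot all_order all_algebra.
From mathcomp Require Import all_classical all_reals all_analysis.
From mathcomp Require Import measurable_realfun.
From mathcomp Require Import ring lra.

Set Implicit Arguments.
Unset Strict Implicit.
Unset Printing Implicit Defensive.

Import Order.TTheory GRing.Theory Num.Theory.
Local Open Scope ring_scope.

(** * Comparison of exponents *)

(** If [g < 1], then [T ^ (1 - g)] would stay below [D], which fails once [T] exceeds
    [D ^ (1 / (1 - g))]. *)
Lemma ge1_of_ler_natr_powR (R : realType) (D g : R) :
  (forall T : nat, (0 < T)%N -> T%:R <= D * T%:R `^ g) -> 1 <= g.
Proof.
move=> h; rewrite leNgt; apply/negP => g1.
have g0 : 0 < 1 - g by rewrite subr_gt0.
have D0 : 0 <= D by have := h 1%N isT; rewrite powR1 mulr1; apply: le_trans.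
pose y := D `^ (1 - g)^-1.
pose T := (Num.bound y).
have yT : y < T%:R by exact: archi_boundP (powR_ge0 _ _).
have T0 : (0 < T)%N by rewrite -(ltr0n R) (le_lt_trans (powR_ge0 _ _) yT).
have T0R : 0 < T%:R :> R by rewrite ltr0n.
have : D < T%:R `^ (1 - g).
  have <- : y `^ (1 - g) = D by rewrite -powRrM mulVf ?gt_eqF// powRr1.
  by rewrite gt0_ltr_powR // nnegrE ?powR_ge0 // ltW.
apply/negP; rewrite -leNgt powRB ?(powRr1 (ltW T0R)); last first.
  by rewrite gt_eqF // implybT.
by rewrite ler_pdivrMr ?powR_gt0 // h.
Qed.

Lemma measurable_from_arm (K : nat) (d : measure_display) (T : measurableType d)
    (g : 'I_K.+1 -> T) : measurable_fun setT g.
Proof. by []. Qed.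

Lemma mean_dirac (R : realType) (x : R) : mean (\d_x : probability R R) = x.
Proof. by rewrite /mean unlock integral_dirac// diracT mul1e. Qed.

(** * Bandits with deterministic rewards *)

Section DeterministicRewards.
Context (R : realType) (K : nat) (v : 'I_K.+1 -> R) (b : 'I_K.+1).
Hypothesis v01 : forall k, 0 <= v k <= 1.
Hypothesis vb : forall k, k != b -> v k < v b.

Lemma dirac_itv01 k : (\d_(v k) : probability R R) `[0, 1]%classic = 1%E.
Proof. by rewrite /= diracE mem_set //= in_itv /= v01. Qed.

Lemma dirac_best_uniq k : k != b ->
  mean (\d_(v k) : probability R R) < mean (\d_(v b) : probability R R).
Proof. by rewrite !mean_dirac; apply: vb. Qed.

Definition dirac_instance : instance R K :=
  Instance dirac_itv01 dirac_best_uniq.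

Context (dU : measure_display) (U : measurableType dU) (alg : algorithm R K U).
Context (dV : measure_display) (V : measurableType dV) (z : V).
Context (f : forall t : nat, V * t.+1.-tuple ('I_K.+1 * R) -> R).
Hypothesis mf : forall t, measurable_fun setT (@f t).

Definition dirac_adversary : adversary R K V :=
  @Adversary R K _ V (\d_z : probability V R) f mf.

(** Constants are independent of everything: the factors other than [seed_law alg A] are 0 or 1. If
    one of them is 0, the event on the left is empty. *)
Lemma dirac_joint_law (n : nat) (A : set U) (B : set V)
    (E : 'I_K.+1 -> nat -> set R) :
    measurable A -> measurable B -> (forall k t, measurable (E k t)) ->
  seed_law alg [set w | [/\ A (idfun w), B ((cst z : U -> V) w) &
      forall k t, (t < n)%N -> E k t ((cst (v k) : U -> R) w)]]%classic =
  (seed_law alg A * adv_seed_law dirac_adversary B *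
   \prod_(k < K.+1) \prod_(t < n) law dirac_instance k (E k t))%E.
Proof.
move=> mA mB mE /=; rewrite diracE.
have [Bz|nBz] := pselect (B z); last first.
  rewrite memNset // mule0 mul0e (_ : [set _ | _]%classic = set0) ?measure0 //.
  by apply/seteqP; split => // w [].
have [Ev|/existsNP[k /existsNP[t /not_implyP[tn nEv]]]] :=
  pselect (forall k t, (t < n)%N -> E k t (v k)).
  rewrite mem_set // mule1 big1 => [|k _].
    by rewrite mule1; congr (_ _); apply/seteqP; split => // w [].
  by rewrite big1 // => t _; rewrite diracE mem_set //; exact: Ev.
rewrite (bigD1 k) // (bigD1 (Ordinal tn)) //= diracE (memNset nEv) !mul0e mule0.
rewrite (_ : [set _ | _]%classic = set0) ?measure0 //.
by apply/seteqP; split => // w [_ _ /(_ k t tn)].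
Qed.

(* All rewards being deterministic, the learner's seed is the only source of
   randomness. *)
Definition dirac_environment :
    environment dirac_instance alg dirac_adversary U :=
  @Environment _ _ _ _ _ _ _ _ _ _ _ (seed_law alg)
    (HB.pack (@idfun U)
       (isMeasurableFun.Build _ _ _ _ _ (@measurable_id _ U setT)) : {mfun U >-> U}) (cst z : {mfun U >-> V})
    (fun k _ => cst (v k) : {mfun U >-> R}) dirac_joint_law.

Local Notation env := dirac_environment.

Lemma measurable_histories T t :
  measurable_fun setT (fun u => (histories env T u t).1) /\
  measurable_fun setT (fun u => (histories env T u t).2).
Proof.
elim: t => [|t [IH1 IH2]] /=; first by split; apply: measurable_cst.
have mi : measurable_fun setT
    (fun u : U => pull alg T (u, (histories env T u t).2)).
  apply: measurableT_comp; first exact: measurable_pull.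
  by apply: measurable_fun_pair => //; exact: measurable_id.
have mraw : measurable_fun setT (fun u => (histories env T u t.+1).1).
  apply: (fun H => measurable_cons H IH1); apply: (measurable_fun_pair mi).
  exact: (measurableT_comp (measurable_from_arm v) mi).
split => //.
apply: (fun H => measurable_cons H IH2); apply: (measurable_fun_pair mi).
apply: measurableT_comp; first exact: mf.
by apply: measurable_fun_pair => //; exact: measurable_cst.
Qed.

Lemma measurable_pulled T t : measurable_fun setT (pulled env T t).
Proof.
apply: measurableT_comp; first exact: measurable_pull.
apply: measurable_fun_pair; first exact: measurable_id.
by case: (measurable_histories T t).
Qed.

(** Both notions of regret reduce to this quantity: the realized regret equals it pathwise, and the
    pseudo-regret is its integral over the seed. *)
Definition gap_sum T u : R := \sum_(t < T) (v b - v (pulled env T t u)).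

Lemma gap_sum_ge0 T u : 0 <= gap_sum T u.
Proof.
apply: sumr_ge0 => t _; rewrite subr_ge0.
by have [->//|/vb/ltW] := eqVneq (pulled env T t u) b.
Qed.

Lemma measurable_gap_sum T : measurable_fun setT (gap_sum T).
Proof.
apply: measurable_sum => t.
apply: measurable_funB => //.
exact: (measurableT_comp (measurable_from_arm v) (measurable_pulled T t)).
Qed.

Lemma realized_regret_dirac T u : realized_regret env T u = gap_sum T u.
Proof.
apply/eqP; rewrite eq_le; apply/andP; split; last first.
  exact: (le_bigmax_cond _ _ (erefl : xpredT b)).
apply/bigmax_leP.
suff h k : regret_against env T k u <= gap_sum T u by split.
apply: ler_sum => t _; apply: lerB => //=.
by have [->//|/vb/ltW] := eqVneq k b.
Qed.

Lemma pseudo_regret_dirac T :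
  pseudo_regret env T = (\int[seed_law alg]_u (gap_sum T u)%:E)%E.
Proof.
rewrite /pseudo_regret unlock; apply: eq_integral => u _ /=.
congr EFin; rewrite mean_dirac /gap_sum sumrB sumr_const card_ord mulr_natl.
by congr (_ - _); apply: eq_bigr => t _; rewrite mean_dirac.
Qed.

Lemma measurable_gap_sum_le T (e : R) :
  measurable [set u | (gap_sum T u <= e)%R]%classic.
Proof.
rewrite -[X in measurable X]setTI; apply: measurable_fun_le => //.
exact: measurable_gap_sum.
Qed.

(** Markov's inequality gives probability at most 1/3 to [e <= gap_sum]. The level 2/3 is chosen
    above 1/2, so that two such events must intersect. *)
Lemma markov_gap_sum T (e : R) : 0 < e ->
  (pseudo_regret env T <= (e / 3)%:E)%E ->
  ((2 / 3)%:E <= seed_law alg [set u | (gap_sum T u <= e)%R]%classic)%E.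
Proof.
move=> e0; rewrite pseudo_regret_dirac => Ee.
have mg : measurable_fun [set: U] (EFin \o gap_sum T).
  by apply/measurable_EFinP; exact: measurable_gap_sum.
pose A := [set u | (e <= gap_sum T u)%R]%classic.
have mA : measurable A.
  rewrite -[A]setTI; apply: measurable_fun_le => //.
  exact: measurable_gap_sum.
have PA : (seed_law alg A <= (3^-1)%:E)%E.
  have := le_integral_abse (seed_law alg) measurableT mg e0.
  rewrite setTI (_ : [set x | _]%classic = A); last first.
    by apply/seteqP; split => u /=; rewrite lee_fin ger0_norm ?gap_sum_ge0.
  under eq_integral do rewrite gee0_abs ?lee_fin ?gap_sum_ge0//.
  move=> /le_trans /(_ Ee).
  by rewrite EFinM lee_pmul2l ?lte_fin.
have -> : (2 / 3)%:E = (1 - (3^-1)%:E)%E :> \bar R.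
  by rewrite -EFinB; congr EFin; lra.
apply: (@le_trans _ _ (seed_law alg (~` A)%classic)).
  by rewrite probability_setC // leeB.
apply: le_measure; rewrite ?inE.
- exact: measurableC.
- exact: measurable_gap_sum_le.
- by move=> u /negP; rewrite -ltNge => /ltW.
Qed.
End DeterministicRewards.

(** Puts the two kinds of regret bound in one form: the pseudo-regret bound through Markov's
    inequality, the realized one with confidence parameter 1/3. *)
Lemma gap_sum_likely (R : realType) (K : nat) (v : 'I_K.+1 -> R) (b : 'I_K.+1)
    (v01 : forall k, 0 <= v k <= 1) (vb : forall k, k != b -> v k < v b)
    (dU : measure_display) (U : measurableType dU) (alg : algorithm R K U)
    (alpha beta : R) :
  pseudo_regret_bound alg alpha beta \/ realized_regret_bound alg alpha beta ->
  exists2 M : R, 0 <= M &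
  forall (dV : measure_display) (V : measurableType dV) (z : V)
    (f : forall t : nat, V * t.+1.-tuple ('I_K.+1 * R) -> R)
    (mf : forall t, measurable_fun setT (@f t)) (T : nat) (c : R),
  (0 < T)%N -> 0 < c ->
  (forall u, total_attack (dirac_environment v01 vb alg z mf) T u <= c) ->
  ((2 / 3)%:E <= seed_law alg [set u |
    (gap_sum v01 vb alg z mf T u <=
     M * (T%:R `^ alpha + c `^ beta))%R]%classic)%E.
Proof.
case=> hreg.
  have [M hM] := hreg (dirac_instance v01 vb).
  (* The factor 3 pays for Markov's inequality; the [+ 1] makes the threshold strictly positive. *)
  exists (3 * (`|M| + 1)); first by rewrite mulr_ge0 // addr_ge0.
  move=> dV V z f mf T c T0 c0 hc; apply: markov_gap_sum.
    apply: mulr_gt0; first by apply: mulr_gt0; rewrite ?ltr_wpDl.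
    by apply: addr_gt0; rewrite powR_gt0 // ltr0n.
  have S0 : 0 <= T%:R `^ alpha + c `^ beta by rewrite addr_ge0 ?powR_ge0.
  apply: (le_trans (hM _ _ _ _ _ _ _ c T0 c0 (aeW _ hc))).
  rewrite lee_fin [leRHS](_ : _ = (`|M| + 1) * (T%:R `^ alpha + c `^ beta)).
    by rewrite ler_wpM2r // (le_trans (ler_norm M)) // lerDl.
  by field.
have d01 : 0 < (3^-1 : R) < 1 by lra.
have [M hM] := hreg (dirac_instance v01 vb) _ d01.
exists `|M| => // dV V z f mf T c T0 c0 hc.
have S0 : 0 <= T%:R `^ alpha + c `^ beta by rewrite addr_ge0 ?powR_ge0.
have -> : 2 / 3 = 1 - 3^-1 :> R by lra.
apply: le_trans
  (hM _ _ _ _ _ _ (dirac_environment v01 vb alg z mf) c T0 c0 (aeW _ hc)) _.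
under eq_set do rewrite realized_regret_dirac.
apply: le_measure; rewrite ?inE; try exact: measurable_gap_sum_le.
by move=> u /= /le_trans; apply; rewrite ler_wpM2r // ler_norm.
Qed.

(** * The adversary's strategy *)

Section Disguise.
Context (R : realType) (K : nat) (k1 : 'I_K.+1) (x c : R).

Definition pulls (s : seq ('I_K.+1 * R)) : R :=
  (count (fun p => p.1 == k1) s)%:R.

(** The seed type [unit] makes the attack deterministic. The head of the history is the current
    round, so the count compared with [c] includes the current pull. *)
Definition disguise (t : nat) (p : unit * t.+1.-tuple ('I_K.+1 * R)) : R :=
  if ((thead p.2).1 == k1) && (pulls p.2 <= c) then x else (thead p.2).2.

Lemma pulls_cons p s : pulls (p :: s) = (p.1 == k1)%:R + pulls s.
Proof. by rewrite /pulls /= natrD. Qed.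

Lemma pulls_fst s1 s2 : map fst s1 = map fst s2 -> pulls s1 = pulls s2.
Proof.
by move=> E; rewrite /pulls -!(count_map fst (pred1 k1)) E.
Qed.

Lemma disguise_cons t z p (s : t.-tuple ('I_K.+1 * R)) :
  disguise (z, [tuple of p :: s]) =
  if (p.1 == k1) && (pulls (p :: s) <= c) then x else p.2.
Proof. by []. Qed.

Lemma measurable_pulls t : measurable_fun setT
  (fun s : t.-tuple ('I_K.+1 * R) => pulls s).
Proof.
have -> : (fun s : t.-tuple ('I_K.+1 * R) => pulls s) =
    (fun s : t.-tuple ('I_K.+1 * R) => \sum_(i < t) ((tnth s i).1 == k1)%:R).
  apply/funext => s; rewrite /pulls -sum1_count natr_sum big_mkcond big_tuple.
  by apply: eq_bigr => i _; case: ifP.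
apply: measurable_sum => i.
apply: (measurableT_comp (measurable_from_arm (fun j => (j == k1)%:R : R))).
by apply: measurableT_comp => //; exact: measurable_tnth.
Qed.

Lemma measurable_disguise t : measurable_fun setT (@disguise t).
Proof.
have mh : measurable_fun setT
  (fun p : unit * t.+1.-tuple ('I_K.+1 * R) => thead p.2).
  by apply: measurableT_comp => //; exact: measurable_tnth.
apply: measurable_fun_ifT => //; last exact: measurableT_comp mh.
apply: measurable_and.
  apply: (measurableT_comp (measurable_from_arm (fun j => j == k1))).
  exact: measurableT_comp mh.
apply: measurable_fun_ler => //.
exact: (measurableT_comp (@measurable_pulls t.+1) measurable_snd).
Qed.
End Disguise.

(** * Coupling of the two instances under a common seed *)

Section Coupling.
Context (R : realType) (K : nat) (v1 v2 : 'I_K.+1 -> R).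
Context (b1 b2 k1 : 'I_K.+1) (c : R).
Hypothesis v1_01 : forall k, 0 <= v1 k <= 1.
Hypothesis v2_01 : forall k, 0 <= v2 k <= 1.
Hypothesis v1_b1 : forall k, k != b1 -> v1 k < v1 b1.
Hypothesis v2_b2 : forall k, k != b2 -> v2 k < v2 b2.
Hypothesis v12 : forall k, k != k1 -> v1 k = v2 k.
Hypothesis c0 : 0 <= c.
Context (dU : measure_display) (U : measurableType dU) (alg : algorithm R K U).
Context (T : nat) (u : U).

Let mf := @measurable_disguise R K k1 (v1 k1) c.
Local Notation env1 := (dirac_environment v1_01 v1_b1 alg tt mf).
Local Notation env2 := (dirac_environment v2_01 v2_b2 alg tt mf).

(** While the count is within [c], arm [k1] shows [v1 k1] in both instances and the other arms pay
    the same, so the learner keeps making the same choices. The raw histories may differ in the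
    rewards of [k1], hence [map fst]. *)
Lemma histories_disguise t : pulls k1 (histories env1 T u t).1 <= c ->
  (histories env2 T u t).2 = (histories env1 T u t).2 /\
  map fst (histories env2 T u t).1 = map fst (histories env1 T u t).1.
Proof.
elim: t => [//|t IH]; rewrite /= pulls_cons => hc.
have [|-> E] := IH; first by rewrite (le_trans _ hc) // lerDr.
rewrite E; split=> //; congr [tuple of (_, _) :: _].
rewrite !disguise_cons !pulls_cons /= (pulls_fst k1 E) hc !andbT.
by case: eqVneq => // /v12 ->.
Qed.

Lemma total_attack_disguise_le : total_attack env2 T u <= c.
Proof.
(* The second invariant carries the induction: a falsified pull costs at most 1 and occurs only
   while the count, itself included, is at most [c]. *)
suff /(_ T)[] : forall n,
    \sum_(t < n) `|raw_reward env2 T t u - attacked_reward env2 T t u| <= c /\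
    \sum_(t < n) `|raw_reward env2 T t u - attacked_reward env2 T t u| <=
      pulls k1 (histories env2 T u n).1 by [].
elim=> [|n [IHc IHp]]; first by rewrite !big_ord0.
rewrite !big_ord_recr /= pulls_cons /attacked_reward /=.
rewrite disguise_cons pulls_cons /=.
rewrite /raw_reward /= -[pull alg T _]/(pulled env2 T n u).
rewrite /attacked_reward /raw_reward /= in IHc IHp.
case: ifP => [/andP[/eqP -> le_c]|_]; last first.
  by rewrite subrr normr0 addr0; split=> //; rewrite (le_trans IHp) // lerDr.
have d1 : `|v2 k1 - v1 k1| <= 1.
  have := v1_01 k1; have := v2_01 k1; rewrite ler_norml; lra.
move: le_c; rewrite eqxx => le_c.
split; last by rewrite addrC lerD.
by rewrite (le_trans _ le_c) // addrC lerD.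
Qed.

(** The value shown for [k1] is its true reward in the first instance. *)
Lemma total_attack_disguise0 : total_attack env1 T u = 0.
Proof.
rewrite /total_attack big1 // => t _.
rewrite /attacked_reward /raw_reward /= disguise_cons /=.
by case: ifP => [/andP[/eqP -> _]|_]; rewrite subrr normr0.
Qed.

Lemma pulls_disguise : pulls k1 (histories env1 T u T).1 <= c ->
  pulls k1 (histories env2 T u T).1 = pulls k1 (histories env1 T u T).1.
Proof. by move=> /histories_disguise[_ E]; exact: pulls_fst. Qed.
End Coupling.

(** * Regret in terms of pull counts *)

Section GapSum.
Context (R : realType) (K : nat) (v : 'I_K.+1 -> R) (b : 'I_K.+1).
Hypothesis v01 : forall k, 0 <= v k <= 1.
Hypothesis vb : forall k, k != b -> v k < v b.
Context (dU : measure_display) (U : measurableType dU) (alg : algorithm R K U).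
Context (dV : measure_display) (V : measurableType dV) (z : V).
Context (f : forall t : nat, V * t.+1.-tuple ('I_K.+1 * R) -> R).
Hypothesis mf : forall t, measurable_fun setT (@f t).
Local Notation env := (dirac_environment v01 vb alg z mf).

Lemma pulls_histories T u k n : pulls k (histories env T u n).1 =
  \sum_(t < n) (pulled env T t u == k)%:R.
Proof.
by elim: n => [|n IH]; rewrite ?big_ord0 // big_ord_recr /= pulls_cons IH addrC.
Qed.

Lemma gap_sum_ge_pulls T u k :
  (v b - v k) * pulls k (histories env T u T).1 <= gap_sum v01 vb alg z mf T u.
Proof.
rewrite pulls_histories mulr_sumr; apply: ler_sum => t _.
have [->|_] := eqVneq (pulled env T t u) k; first by rewrite mulr1.
rewrite mulr0 subr_ge0.
by have [->//|/vb/ltW] := eqVneq (pulled env T t u) b.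
Qed.

Lemma gap_sum_ge_subpulls T u (g : R) : (forall k, k != b -> g <= v b - v k) ->
  g * (T%:R - pulls b (histories env T u T).1) <= gap_sum v01 vb alg z mf T u.
Proof.
move=> hg.
rewrite pulls_histories -[T in T%:R]card_ord -sumr_const -sumrB mulr_sumr.
apply: ler_sum => t _.
have [->|] := eqVneq (pulled env T t u) b; first by rewrite !subrr mulr0.
by rewrite subr0 mulr1; exact: hg.
Qed.
End GapSum.

(** * Combination of the two instances *)

Lemma likely_events_meet (d : measure_display) (U : measurableType d)
    (R : realType) (P : probability U R) (A B : set U) :
  measurable A -> measurable B ->
  ((2 / 3)%:E <= P A)%E -> ((2 / 3)%:E <= P B)%E -> exists u, A u /\ B u.
Proof.
move=> mA mB PA PB; apply: contrapT => /forallNP AB.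
have : (P A <= P (~` B)%classic)%E.
  apply: le_measure; rewrite ?inE //; first exact: measurableC.
  by move=> u Au Bu; apply: (AB u).
rewrite probability_setC // leNgt => /negP; apply.
rewrite (lt_le_trans _ PA) // lteBlDr ?fin_num_measure //.
apply: (@lt_le_trans _ _ ((2 / 3)%:E + (2 / 3)%:E)%E); last by rewrite leeD2l.
by rewrite -EFinD lte_fin; lra.
Qed.

Theorem proposition4 (R : realType) (K : nat) (hK : (2 <= K.+1)%N)
    (dU : measure_display) (U : measurableType dU) (alg : algorithm R K U)
    (alpha beta : R) (halpha : 2^-1 <= alpha < 1)
    (hreg : pseudo_regret_bound alg alpha beta \/
            realized_regret_bound alg alpha beta) :
  1 / alpha <= beta.
Proof.
have /andP[ge_alpha lt_alpha] := halpha.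
have alpha0 : 0 < alpha by lra.
pose v1 (k : 'I_K.+1) : R := if k == ord0 then 2^-1 else 0.
pose v2 (k : 'I_K.+1) : R := if k == ord_max then 1 else v1 k.
have v1_01 k : 0 <= v1 k <= 1 by rewrite /v1; case: ifP => _; lra.
have v2_01 k : 0 <= v2 k <= 1.
  by rewrite /v2; case: ifP => _; [lra | exact: v1_01].
(* By [hK] there are at least two arms, so [ord_max] differs from [ord0]. *)
have v1_max : v1 ord_max = 0.
  by rewrite /v1 ifF //; apply/negbTE; rewrite -(inj_eq val_inj) /= -lt0n.
have v1_0 : v1 ord0 = 2^-1 by rewrite /v1 eqxx.
have v2_max : v2 ord_max = 1 by rewrite /v2 eqxx.
have v1_le k : v1 k <= 2^-1 by rewrite /v1; case: ifP => _; lra.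
have v12 k : k != ord_max -> v1 k = v2 k by rewrite /v2 => /negbTE ->.
have v1_best k : k != ord0 -> v1 k < v1 ord0.
  by rewrite v1_0 /v1 => /negbTE ->; lra.
have v2_gap k : k != ord_max -> 2^-1 <= v2 ord_max - v2 k.
  by move=> /v12 <-; have := v1_le k; lra.
have v2_best k : k != ord_max -> v2 k < v2 ord_max.
  by move=> /v2_gap; lra.
(* Both constants are fixed before the horizon, so the attack may depend on [T] through its
   budget. *)
have [M1 M1_ge0 h1] := gap_sum_likely v1_01 v1_best hreg.
have [M2 M2_ge0 h2] := gap_sum_likely v2_01 v2_best hreg.
(* In the first instance half the pull count of [ord_max] will be at most [M1 * (T ^ alpha + 1)],
   hence at most [2 * M1 * T ^ alpha]. The [+ 1] keeps [A] positive when [M1 = 0]. *)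
pose A := 4 * (M1 + 1).
have A0 : 0 < A by rewrite /A; lra.
pose g := Num.max alpha (alpha * beta).
suff : 1 <= g.
  by rewrite le_max leNgt lt_alpha /= ler_pdivrMr // mulrC.
(* [A] accounts for the pulls of the last arm; the other term accounts for the remaining rounds,
   each costing at least 1/2 in the second instance. *)
apply: (@ge1_of_ler_natr_powR _ (A + 2 * M2 * (1 + A `^ beta))) => T T0.
have T1 : 1 <= T%:R :> R by rewrite ler1n.
have Ta1 : 1 <= T%:R `^ alpha.
  by have := ler_powR T1 (ltW alpha0); rewrite powRr0.
pose c := A * T%:R `^ alpha.
have c0 : 0 < c by rewrite mulr_gt0 // (lt_le_trans ltr01).
pose md := @measurable_disguise R K ord_max (v1 ord_max) c.
pose env1 := dirac_environment v1_01 v1_best alg tt md.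
pose env2 := dirac_environment v2_01 v2_best alg tt md.
(* The true total is 0, but the regret bounds ask for a positive budget; with 1, the term in [beta]
   is just 1. *)
have attack1 u : total_attack env1 T u <= 1.
  by rewrite /env1 total_attack_disguise0.
have attack2 u : total_attack env2 T u <= c.
  by apply: total_attack_disguise_le => //; exact: ltW.
have [u [/= H1 H2]] := likely_events_meet
  (measurable_gap_sum_le v1_01 v1_best alg tt md T _)
  (measurable_gap_sum_le v2_01 v2_best alg tt md T _)
  (h1 _ _ _ _ _ _ _ T0 ltr01 attack1) (h2 _ _ _ _ _ _ _ T0 c0 attack2).
have n1c : pulls ord_max (histories env1 T u T).1 <= c.
  have := le_trans (gap_sum_ge_pulls v1_01 v1_best alg tt md T u ord_max) H1.
  rewrite (_ : v1 ord0 - v1 ord_max = 2^-1) ?powR1; last by lra.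
  have : M1 * (T%:R `^ alpha + 1) <= M1 * (2 * T%:R `^ alpha).
    by apply: ler_wpM2l => //; lra.
  rewrite /c /A; lra.
have Tc := le_trans (gap_sum_ge_subpulls v2_01 v2_best alg tt md T u v2_gap) H2.
(* The count in the second instance becomes that of the first, already bounded by [c]. *)
rewrite (pulls_disguise v2_01 v2_best v12 n1c) in Tc.
have cb : c `^ beta = A `^ beta * T%:R `^ (alpha * beta).
  by rewrite /c powRM ?powR_ge0 ?(ltW A0) // powRrM.
have Tag : T%:R `^ alpha <= T%:R `^ g.
  by apply: ler_powR; rewrite // le_max lexx.
have Tabg : T%:R `^ (alpha * beta) <= T%:R `^ g.
  by apply: ler_powR; rewrite // le_max lexx orbT.
have cg : c <= A * T%:R `^ g by apply: ler_wpM2l => //; exact: ltW.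
have Sg : T%:R `^ alpha + c `^ beta <= (1 + A `^ beta) * T%:R `^ g.
  by rewrite mulrDl mul1r cb lerD // ler_wpM2l // powR_ge0.
have := ler_wpM2l M2_ge0 Sg.
lra.
Qed.
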